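(* Let $(V,\mathcal{S})$ be a set system with $V=\{1,\dots,n\}$ in which every element lies in at most $t$ sets, and run the algorithm described in the context. Fix a set $S\in\mathcal{S}$ and let $D_S(T)=\sum_{i\in S}x_T(i)$. Then for every $\lambda\ge 0$, \[ \Pr\left[|D_S(T)|\ge\lambda\sqrt{t}\right]\le 8\exp\!\left(-\lambda^2/(100a)\right). \]
   Context: Algorithm. Parameters: $\gamma=1/(n^2\log n)$, $T=(12/\gamma^2)\log n$, $a=6$. Initialize $x_0=0\in\mathbb{R}^n$ and $A_1=V$. For $k=1,2,\dots,T$: let $\mathcal{B}_k=\{S\in\mathcal{S}:|S\cap A_k|\ge at\}$ (''big'' sets) and $\mathcal{L}_k=\mathcal{S}\setminus\mathcal{B}_k$ (''small'' sets). Compute an optimal solution $(u_i^k)_{i\in A_k}$, $u_i^k\in\mathbb{R}^n$, of the semidefinite program: maximize $\sum_{i\in A_k}\|u_i\|_2^2$ subject to $\|\sum_{i\in S\cap A_k}u_i\|_2^2=0$ for each $S\in\mathcal{B}_k$; $\|\sum_{i\in S\cap A_k}u_i\|_2^2\le 2\sum_{i\in S\cap A_k}\|u_i\|_2^2$ for each $S\in\mathcal{L}_k$; $\|\sum_{i\in S\cap A_k}x_{k-1}(i)u_i\|_2^2\le 2\sum_{i\in S\cap A_k}\|u_i\|_2^2$ for each $S\in\mathcal{L}_k$; $\|u_i\|_2^2\le 1$ for each $i\in A_k$. Draw $r_k\in\{-1,1\}^n$ with independent uniformly random coordinates (independently of the past). Set $x_k(i)=x_{k-1}(i)+\gamma\langle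 r_k,u_i^k\rangle$ for $i\in A_k$ and $x_k(i)=x_{k-1}(i)$ for $i\notin A_k$. Set $A_{k+1}=A_k\setminus\{i:|x_k(i)|\ge 1-1/n\}$. The vector $x_T$ is the fractional coloring after step $T$ (before any final rounding). *)

(* Defs.v *)
From HB Require Import structures.
From mathcomp Require Import all_boot all_order all_algebra.
From mathcomp Require Import reals sequences exp.

Set Implicit Arguments.
Unset Strict Implicit.
Unset Printing Implicit Defensive.
Import Order.TTheory GRing.Theory Num.Theory.

Local Open Scope ring_scope.

Section Euclidean.
Variables (R : realType) (n : nat).

Definition dot (u v : 'rV[R]_n) : R := \sum_j u 0 j * v 0 j.

(* The norm `|u| that the libraries put on 'rV[R]_n is the sup norm, hence
   this separate definition of the squared Euclidean norm. *)
Definition sqnorm2 (u : 'rV[R]_n) : R := dot u u.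

End Euclidean.

Definition max_degree (n : nat) (Sys : {set {set 'I_n}}) (t : nat) : Prop :=
  forall i : 'I_n, (#|[set S in Sys | i \in S]| <= t)%N.

Definition param_a : nat := 6.

Definition gamma (R : realType) (n : nat) : R := 1 / (n%:R ^+ 2 * ln n%:R).

(* (12 / gamma^2) log n, rounded up to an integer. *)
Definition num_steps (R : realType) (n : nat) : nat :=
  `|Num.ceil (12 / gamma R n ^+ 2 * ln n%:R)|%N.

Section SDP.
Variables (R : realType) (n : nat) (Sys : {set {set 'I_n}}) (t : nat).

Definition big_sets (A : {set 'I_n}) : {set {set 'I_n}} :=
  [set S in Sys | (param_a * t <= #|S :&: A|)%N].

Definition small_sets (A : {set 'I_n}) : {set {set 'I_n}} :=
  Sys :\: big_sets A.

(* A family (u_i)_{i in A} is encoded as a total function on 'I_n; neither the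
   constraints nor the objective look at u i for i \notin A. *)
Record sdp_feasible (A : {set 'I_n}) (x : 'I_n -> R) (u : 'I_n -> 'rV[R]_n) :
    Prop := SdpFeasible {
  sdp_big : forall S, S \in big_sets A ->
    sqnorm2 (\sum_(i in S :&: A) u i) = 0;
  sdp_small : forall S, S \in small_sets A ->
    sqnorm2 (\sum_(i in S :&: A) u i)
      <= 2 * \sum_(i in S :&: A) sqnorm2 (u i);
  sdp_small_weighted : forall S, S \in small_sets A ->
    sqnorm2 (\sum_(i in S :&: A) x i *: u i)
      <= 2 * \sum_(i in S :&: A) sqnorm2 (u i);
  sdp_unit : forall i, i \in A -> sqnorm2 (u i) <= 1
}.

Definition sdp_value (A : {set 'I_n}) (u : 'I_n -> 'rV[R]_n) : R :=
  \sum_(i in A) sqnorm2 (u i).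

Definition sdp_optimal (A : {set 'I_n}) (x : 'I_n -> R)
    (u : 'I_n -> 'rV[R]_n) : Prop :=
  sdp_feasible A x u /\
  forall v, sdp_feasible A x v -> sdp_value A v <= sdp_value A u.

End SDP.

(* A vector of {-1, 1}^n, with true coding -1. *)
Definition signs (n : nat) := {ffun 'I_n -> bool}.

Definition sign_vec (R : realType) (n : nat) (r : signs n) : 'rV[R]_n :=
  \row_j (-1) ^+ r j.

Section Algorithm.
Variables (R : realType) (n : nat).

(* A history is the list [:: r_k; ...; r_1] of the sign vectors drawn so far,
   most recent first.  A solver gives the vectors (u_i^(k+1))_i used at the next
   step; its choice among the optimal solutions may depend on the whole history
   but, by its type, not on the future draws. *)
Definition solver := seq (signs n) -> 'I_n -> 'rV[R]_n.

Definition next_coloring (A : {set 'I_n}) (x : 'I_n -> R)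
    (u : 'I_n -> 'rV[R]_n) (r : signs n) : 'I_n -> R :=
  fun i => if i \in A then x i + gamma R n * dot (sign_vec R r) (u i) else x i.

Definition next_alive (A : {set 'I_n}) (x : 'I_n -> R) : {set 'I_n} :=
  A :\: [set i | 1 - 1 / n%:R <= `|x i| ].

(* The pair (x_k, A_{k+1}) reached after the history [:: r_k; ...; r_1]. *)
Fixpoint state (sol : solver) (h : seq (signs n)) :
    ('I_n -> R) * {set 'I_n} :=
  match h with
  | [::] => (fun=> 0, [set: 'I_n])
  | r :: h' =>
      let: (x, A) := state sol h' in
      let x' := next_coloring A x (sol h') r in
      (x', next_alive A x')
  end.

Definition coloring (sol : solver) (h : seq (signs n)) : 'I_n -> R :=
  (state sol h).1.

Definition alive (sol : solver) (h : seq (signs n)) : {set 'I_n} :=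
  (state sol h).2.

Definition optimal_solver (Sys : {set {set 'I_n}}) (t : nat) (sol : solver) :
    Prop :=
  forall h : seq (signs n), (size h < num_steps R n)%N ->
    sdp_optimal Sys t (alive sol h) (coloring sol h) (sol h).

(* An outcome lists the draws in chronological order r_1, ..., r_T. *)
Definition outcome := (num_steps R n).-tuple (signs n).

Definition final_disc (sol : solver) (S : {set 'I_n}) (w : outcome) : R :=
  \sum_(i in S) coloring sol (rev w) i.

End Algorithm.

(* The uniform law on a finite type.  On outcome R n it makes r_1, ..., r_T
   independent, with independent uniform coordinates in {-1, 1}. *)
Definition unif_pr (R : realType) (Omega : finType) (E : {set Omega}) : R :=
  #|E|%:R / #|Omega|%:R.

(* Main.v *)
Require Import Defs.
From HB Require Import structures.
From mathcomp Require Import all_boot all_order all_algebra.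
From mathcomp Require Import reals topology normedtype sequences derive exp.
From mathcomp Require Import ring lra.

Set Implicit Arguments.
Unset Strict Implicit.
Unset Printing Implicit Defensive.
Import Order.TTheory GRing.Theory Num.Theory.
Import numFieldNormedType.Exports.

Local Open Scope ring_scope.

(** While S is big its discrepancy does not move.  Once it is small, fewer than
    6 t of its elements are alive, and every step of the walk changes
    D = \sum_(i in S) x i with a variance bounded by twice the expected increase
    of the energy \sum_i x i ^ 2 over the alive elements of S, whose own
    fluctuation is bounded in the same way.  Hence, for |theta| <= 1/32,
      exp (theta D + 8 theta^2 \sum_(i in S alive) (25/16 - x i ^ 2))
    is a supermartingale, where 5/4 bounds all the |x i|; this yields
    E [exp (theta D)] <= exp (75 theta^2 t).  Markov's inequality with
    theta = lambda / (480 sqrt t) concludes.  The condition on theta costs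
    nothing: |D| <= 15 t always, so only lambda <= 15 sqrt t matters. *)

(** * Elementary inequalities for the exponential and the logarithm *)

Section ExpBounds.
Variable R : realType.
Implicit Types x y z : R.

Lemma ge0_is_derive_le (f f' : R -> R) :
  (forall x, is_derive x 1 f (f' x)) -> (forall x, 0 <= x -> 0 <= f' x) ->
  forall x, 0 <= x -> f 0 <= f x.
Proof.
move=> df f'_ge0 x x_ge0.
have drv y : derivable f y 1 by have [] := df y.
apply: (@ger0_derive1_ndecr _ f 0 x) => //.
- move=> y; rewrite in_itv/= => /andP[/ltW y_ge0 _].
  by rewrite derive1E (@derive_val _ _ _ _ _ _ _ (df y)) f'_ge0.
- apply: continuous_subspaceT => y.
  exact/differentiable_continuous/derivable1_diffP.
Qed.

Lemma sinh_ge0 x : 0 <= x -> 0 <= expR x - expR (- x).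
Proof. by move=> x_ge0; rewrite subr_ge0 ler_expR; lra. Qed.

Lemma sinh_le_cosh x : 0 <= x ->
  expR x - expR (- x) <= x * (expR x + expR (- x)).
Proof.
move=> x_ge0; rewrite -subr_ge0.
pose f y := y * (expR y + expR (- y)) - (expR y - expR (- y)) : R.
have /= := @ge0_is_derive_le f (fun y => y * (expR y - expR (- y))) _ _ x x_ge0.
rewrite /f !oppr0 expR0 mul0r !subrr; apply.
- move=> y; apply: is_derive_eq; rewrite /GRing.scale /=; ring.
- by move=> y y_ge0; rewrite mulr_ge0 ?sinh_ge0.
Qed.

(** Both sides are even. For [x >= 0], cosh x times exp(-x^2/2) is nonincreasing: its derivative has
    the sign of sinh x - x cosh x, which [sinh_le_cosh] controls. *)
Lemma cosh_le_expR_sqr x : (expR x + expR (- x)) / 2 <= expR (x ^+ 2 / 2).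
Proof.
wlog x_ge0 : x / 0 <= x.
  move=> H; have [/H//|/ltW x_le0] := lerP 0 x.
  by have := H (- x); rewrite opprK sqrrN addrC; apply; lra.
pose f y := - ((expR y + expR (- y)) * expR (- (y ^+ 2 / 2))) : R.
pose f' y := (y * (expR y + expR (- y)) - (expR y - expR (- y))) *
   expR (- (y ^+ 2 / 2)).
have : f 0 <= f x.
  apply: (@ge0_is_derive_le f f') => // y.
    by apply: is_derive_eq; rewrite /GRing.scale /= /f'; field.
  by move=> y_ge0; rewrite /f' mulr_ge0 ?expR_ge0// subr_ge0 sinh_le_cosh.
rewrite /f expr0n/= mul0r !oppr0 expR0 mulr1 lerN2.
by rewrite [expR (- (_ / _))]expRN !ler_pdivrMr ?expR_gt0//; lra.
Qed.

(** From exp(-z) <= 1/(1+z): the product (1+z)(1 - 3z/4) is at least 1 exactly when z lies between 0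
    and 1/3. *)
Lemma expRN_le_affine z : 0 <= z <= 1 / 3 -> expR (- z) <= 1 - 3 / 4 * z.
Proof.
move=> /andP[z_ge0 z_le]; rewrite expRN -div1r ler_pdivrMr ?expR_gt0//.
by have := expR_ge1Dx z; nra.
Qed.

Lemma ln_nat_ge2 (n : nat) : (2 <= n)%N -> 1 / 2 <= ln (n%:R : R).
Proof.
move=> n_ge2; have n_ge2' : 2 <= n%:R :> R by rewrite ler_nat.
apply: (@le_trans _ _ (ln 2)); last by rewrite ler_ln ?posrE//; lra.
have := @le_ln1Dx R (- (1 / 2)); have -> : 1 + - (1 / 2) = 2^-1 :> R by field.
by rewrite lnV ?posrE//; lra.
Qed.

End ExpBounds.

(** * Size of the step parameter [gamma] *)

Lemma gamma_ge0 (R : realType) (n : nat) : 0 <= gamma R n.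
Proof.
rewrite /gamma divr_ge0// mulr_ge0// ?exprn_ge0//.
by case: n => [|n]; [rewrite ln0// | rewrite ln_ge0// ler1n].
Qed.

(** The denominator n^2 log n is 0 for n = 0 and n = 1, and the inverse of 0 is 0; the walk then
    never moves. *)
Lemma gamma_small (R : realType) (n : nat) : (n <= 1)%N -> gamma R n = 0.
Proof.
case: n => [|[|//]] _; first by rewrite /gamma expr0n mul0r invr0 mulr0.
by rewrite /gamma ln1 mulr0 invr0 mulr0.
Qed.

Lemma gamma_mul_sqr_le (R : realType) (n : nat) : gamma R n * n%:R ^+ 2 <= 2.
Proof.
have [n_ge2|/gamma_small->] := leqP 2 n; last by rewrite mul0r.
have n_gt0 : 0 < n%:R :> R by rewrite ltr0n (leq_trans _ n_ge2).
have ln_ge := @ln_nat_ge2 R n n_ge2.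
have -> : gamma R n * n%:R ^+ 2 = (ln n%:R)^-1.
  by rewrite /gamma; field; rewrite !gt_eqF//; lra.
by rewrite -[leRHS]invrK lef_pV2 ?posrE; lra.
Qed.

Lemma gamma_mul_le1 (R : realType) (n : nat) : gamma R n * n%:R <= 1.
Proof.
have [n_ge2|/gamma_small->] := leqP 2 n; last by rewrite mul0r.
have n_ge2' : 2 <= n%:R :> R by rewrite ler_nat.
by have := gamma_mul_sqr_le R n; have := gamma_ge0 R n; nra.
Qed.

(** Bounds the square of one step of a coordinate. The right-hand side is chosen so that a
    coordinate still alive, at most 1 - 1/n, lands at most at 5/4. *)
Lemma gamma_sqr_mul_le (R : realType) (n : nat) :
  gamma R n ^+ 2 * n%:R <= (1 / n%:R + 1 / 4) ^+ 2.
Proof.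
have [n_ge2|/gamma_small->] := leqP 2 n; last by rewrite expr0n mul0r sqr_ge0.
have n_ge2' : 2 <= n%:R :> R by rewrite ler_nat.
have := gamma_mul_sqr_le R n; have := gamma_ge0 R n.
move: (gamma R n) (n%:R : R) n_ge2' => g m m_ge2 g_ge0 gm2.
have m_gt0 : 0 < m by lra.
have gm4 : g ^+ 2 * m ^+ 4 <= 4.
  have -> : g ^+ 2 * m ^+ 4 = (g * m ^+ 2) ^+ 2 by ring.
  have : 0 <= g * m ^+ 2 by rewrite mulr_ge0 ?sqr_ge0.
  nra.
(* Over the denominator m^4 the claim follows from 4m <= (m + m^2/4)^2, true from m = 2 on. *)
have -> : (1 / m + 1 / 4) ^+ 2 = (m + m ^+ 2 / 4) ^+ 2 / m ^+ 4.
  by field; rewrite gt_eqF.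
rewrite ler_pdivlMr ?exprn_gt0// mulrAC.
apply: (@le_trans _ _ (4 * m)); first by rewrite ler_pM2r.
nra.
Qed.

(** * Averages over a uniform sign vector, and the one-step estimate *)

Section SignAverages.
Variables (R : realType) (n : nat).
Implicit Types (u v w : 'rV[R]_n) (r : signs n).

Lemma dotDr u v w : dot u (v + w) = dot u v + dot u w.
Proof.
by rewrite /dot -big_split; apply: eq_bigr => j _; rewrite mxE mulrDr.
Qed.

Lemma dotZr c u v : dot u (c *: v) = c * dot u v.
Proof.
by rewrite /dot big_distrr; apply: eq_bigr => j _; rewrite mxE mulrCA.
Qed.

Lemma dot_sumr (I : finType) (B : {set I}) u (v : I -> 'rV[R]_n) :
  dot u (\sum_(i in B) v i) = \sum_(i in B) dot u (v i).
Proof.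
rewrite /dot exchange_big; apply: eq_bigr => j _.
by rewrite summxE big_distrr.
Qed.

Lemma sqnorm2_ge0 u : 0 <= sqnorm2 u.
Proof. by apply: sumr_ge0 => j _; rewrite -expr2 sqr_ge0. Qed.

Lemma sqnorm2_eq0 u : sqnorm2 u = 0 -> u = 0.
Proof.
move=> u0; apply/rowP => j; rewrite mxE; apply/eqP; rewrite -sqrf_eq0 expr2.
move/eqP: u0; rewrite psumr_eq0 => [/allP/(_ j)|i _].
  by rewrite mem_index_enum => /(_ isT).
by rewrite -expr2 sqr_ge0.
Qed.

Lemma sqnorm2Z c u : sqnorm2 (c *: u) = c ^+ 2 * sqnorm2 u.
Proof.
rewrite /sqnorm2 /dot big_distrr; apply: eq_bigr => j _ /=.
by rewrite !mxE; ring.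
Qed.

(* The weights are those for which the bound is tight when v = u / 2. *)
Lemma sqnorm2D_le u v : sqnorm2 (u + v) <= 3 / 2 * sqnorm2 u + 3 * sqnorm2 v.
Proof.
rewrite /sqnorm2 /dot !big_distrr -big_split; apply: ler_sum => j _ /=.
by rewrite !mxE; have := sqr_ge0 (u 0 j - 2 * v 0 j); lra.
Qed.

Lemma sqr_sum_le (F : 'I_n -> R) :
  (\sum_j F j) ^+ 2 <= n%:R * \sum_j F j ^+ 2.
Proof.
set s := \sum_j F j; set q := \sum_j _.
have [n0|n_gt0] := posnP n.
  have -> : s = 0.
    by rewrite /s big1// => j; have := ltn_ord j; rewrite [X in (_ < X)%N]n0.
  by rewrite expr0n mulr_ge0// sumr_ge0// => j _; rewrite sqr_ge0.
have N_gt0 : 0 < n%:R :> R by rewrite ltr0n.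
rewrite -subr_ge0 -(pmulr_rge0 _ N_gt0).
(* Cauchy-Schwarz as the nonnegativity of an empirical variance. *)
have -> : n%:R * (n%:R * q - s ^+ 2) = \sum_j (n%:R * F j - s) ^+ 2.
  have sqrE j : (n%:R * F j - s) ^+ 2
      = n%:R ^+ 2 * F j ^+ 2 + (- (2 * n%:R * s) * F j + s ^+ 2) by ring.
  under eq_bigr do rewrite sqrE.
  rewrite !big_split -!big_distrr /= -/s -/q sumr_const card_ord -mulr_natl.
  ring.
by apply: sumr_ge0 => j _; rewrite sqr_ge0.
Qed.

Lemma dot_signE r u : dot (sign_vec R r) u = \sum_j (-1) ^+ r j * u 0 j.
Proof. by apply: eq_bigr => j _; rewrite mxE. Qed.

Lemma sqr_dot_sign_le r u : dot (sign_vec R r) u ^+ 2 <= n%:R * sqnorm2 u.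
Proof.
rewrite dot_signE (le_trans (sqr_sum_le _))// ler_wpM2l// ler_sum// => j _.
by rewrite exprMn sqrr_sign mul1r expr2.
Qed.

Lemma card_signs : #|{: signs n}| = (2 ^ n)%N.
Proof. by rewrite card_ffun card_bool card_ord. Qed.

(** The exponential factors over the independent coordinates; each factor sums to 2 cosh(u_j),
    bounded by [cosh_le_expR_sqr]. *)
Lemma sum_sign_expR u :
  \sum_(r : signs n) expR (dot (sign_vec R r) u)
    <= #|{: signs n}|%:R * expR (sqnorm2 u / 2).
Proof.
under eq_bigr => r _ do rewrite dot_signE expR_sum.
rewrite -(bigA_distr_bigA (fun j b => expR ((-1) ^+ (b : bool) * u 0 j))).
rewrite card_signs natrX /sqnorm2 /dot big_distrl expR_sum /=.
rewrite -[n in 2 ^+ n]card_ord -prodr_const -big_split /=.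
apply: ler_prod => j _; rewrite sumr_ge0 => [|b _]; last exact: expR_ge0.
rewrite big_bool /= expr1 expr0 mulN1r mul1r addrC -expr2.
by have := cosh_le_expR_sqr (u 0 j); lra.
Qed.

(** Flipping the sign of coordinate j permutes the sign vectors and negates every summand. *)
Lemma sum_sign_neq (j k : 'I_n) : j != k ->
  \sum_(r : signs n) (-1) ^+ r j * (-1) ^+ r k = 0 :> R.
Proof.
move=> jk; pose flip r : signs n := [ffun i => (i == j) (+) r i].
have flipK : involutive flip.
  by move=> r; apply/ffunP => i; rewrite !ffunE addbA addbb.
set s := LHS; suff : s = - s by lra.
rewrite {1}/s (reindex_inj (inv_inj flipK)) /= /s -sumrN; apply: eq_bigr => r _.
by rewrite !ffunE eqxx eq_sym (negbTE jk) /= signrN mulNr.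
Qed.

Lemma sum_sign_sqr u :
  \sum_(r : signs n) dot (sign_vec R r) u ^+ 2 = #|{: signs n}|%:R * sqnorm2 u.
Proof.
under eq_bigr => r _.
  rewrite dot_signE expr2 big_distrlr /=.
  over.
rewrite exchange_big /sqnorm2 /dot big_distrr; apply: eq_bigr => j _ /=.
rewrite exchange_big (bigD1 j)//= [X in _ + X]big1 ?addr0 => [|k kj].
  under eq_bigr do rewrite mulrACA -expr2 sqrr_sign mul1r.
  by rewrite sumr_const mulr_natl.
under eq_bigr do rewrite mulrACA.
by rewrite -big_distrl /= sum_sign_neq ?mul0r// eq_sym.
Qed.

Lemma expRD_le_mean (a b : R) :
  expR (a + b) <= (expR (2 * a) + expR (2 * b)) / 2.
Proof.
rewrite expRD !expRM_natl ler_pdivlMr//.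
by have := sqr_ge0 (expR a - expR b); rewrite sqrrB; lra.
Qed.

(* The drift of the squares outweighs the variance of the linear part.  The two
   are correlated; AM-GM separates them. *)
Lemma sum_sign_step (B : {set 'I_n}) (U : 'I_n -> 'rV[R]_n) (x : 'I_n -> R)
    (g theta : R) :
  0 <= g -> g * n%:R <= 1 -> `|theta| <= 1 / 32 ->
  sqnorm2 (\sum_(i in B) U i) <= 2 * \sum_(i in B) sqnorm2 (U i) ->
  sqnorm2 (\sum_(i in B) x i *: U i) <= 2 * \sum_(i in B) sqnorm2 (U i) ->
  (forall i, i \in B -> sqnorm2 (U i) <= 1) ->
  \sum_(r : signs n) expR (
      theta * (\sum_(i in B) g * dot (sign_vec R r) (U i))
      - 8 * theta ^+ 2 * (\sum_(i in B) ((x i + g * dot (sign_vec R r) (U i)) ^+ 2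
                                         - x i ^+ 2)))
    <= #|{: signs n}|%:R.
Proof.
move=> g_ge0 gn theta_le; set W := (\sum_(i in B) sqnorm2 _) => hU hx U_le1.
have W_ge0 : 0 <= W by apply: sumr_ge0 => i _; exact: sqnorm2_ge0.
have W_le : W <= n%:R.
  rewrite (@le_trans _ _ (\sum_(i in B) 1))//; first exact: ler_sum.
  by rewrite sumr_const ler_nat -[leqRHS]card_ord max_card.
have theta2 : theta ^+ 2 <= 1 / 1024.
  by move: theta_le; rewrite ler_norml => /andP[]; nra.
(* The part of the exponent linear in r is the product with [v]; 16 is 8 times the 2 of the cross
   term of the square. [Z] is the quadratic remainder. *)
pose v := (g * theta) *: (\sum_(i in B) U i)
          + (- (16 * theta ^+ 2 * g)) *: (\sum_(i in B) x i *: U i).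
pose Z r := \sum_(i in B) (g * dot (sign_vec R r) (U i)) ^+ 2.
(* 9 = 2 (3/2 * 2 + 3 * 1/4 * 2), by [sqnorm2D_le] and both SDP bounds; the 1/4 is 256 theta^2 <=
   1/4, whence the condition on theta. *)
pose K := 9 * theta ^+ 2 * g ^+ 2 * W.
have v_le : 2 * sqnorm2 v <= K.
  have := sqnorm2D_le ((g * theta) *: (\sum_(i in B) U i))
          ((- (16 * theta ^+ 2 * g)) *: (\sum_(i in B) x i *: U i)).
  rewrite -/v !sqnorm2Z /K => Hv.
  have c1 : (g * theta) ^+ 2 * sqnorm2 (\sum_(i in B) U i)
      <= (g * theta) ^+ 2 * (2 * W) by rewrite ler_wpM2l// sqr_ge0.
  have c2 : (- (16 * theta ^+ 2 * g)) ^+ 2 * sqnorm2 (\sum_(i in B) x i *: U i)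
      <= (g * theta) ^+ 2 / 4 * (2 * W).
    apply: ler_pM => //; rewrite ?sqr_ge0 ?sqnorm2_ge0//.
    have : 0 <= (g * theta) ^+ 2 by rewrite sqr_ge0.
    have -> : (- (16 * theta ^+ 2 * g)) ^+ 2
       = (g * theta) ^+ 2 * (256 * theta ^+ 2) by ring.
    by move: theta2; nra.
  by rewrite exprMn in c1 c2 Hv *; nra.
have sumZ : \sum_(r : signs n) Z r = #|{: signs n}|%:R * (g ^+ 2 * W).
  rewrite /Z exchange_big /= /W !big_distrr; apply: eq_bigr => i _ /=.
  under eq_bigr do rewrite exprMn.
  by rewrite -big_distrr /= sum_sign_sqr; ring.
have Z_ge0 r : 0 <= Z r by apply: sumr_ge0 => i _; rewrite sqr_ge0.
have Z_le1 r : Z r <= 1.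
  apply: (@le_trans _ _ (\sum_(i in B) (g ^+ 2 * (n%:R * sqnorm2 (U i))))).
    apply: ler_sum => i _; rewrite exprMn ler_wpM2l ?sqr_ge0//.
    exact: sqr_dot_sign_le.
  rewrite -!big_distrr /= -/W.
  apply: (@le_trans _ _ (g ^+ 2 * (n%:R * n%:R))).
    by rewrite ler_wpM2l ?sqr_ge0// ler_wpM2l.
  rewrite -expr2 -exprMn expr_le1// mulr_ge0//.
(* The shift by K/2 balances the halves: once doubled by AM-GM, the first averages at most 1 since 2
   |v|^2 <= K, the second since 12 theta^2 g^2 W >= K. *)
have split_exponent r :
    theta * (\sum_(i in B) g * dot (sign_vec R r) (U i))
    - 8 * theta ^+ 2 * (\sum_(i in B) ((x i + g * dot (sign_vec R r) (U i)) ^+ 2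
                                       - x i ^+ 2))
    = (dot (sign_vec R r) v - K / 2) + (K / 2 - 8 * theta ^+ 2 * Z r).
  have -> : \sum_(i in B) ((x i + g * dot (sign_vec R r) (U i)) ^+ 2 - x i ^+ 2)
    = 2 * g * dot (sign_vec R r) (\sum_(i in B) x i *: U i) + Z r.
    rewrite dot_sumr big_distrr -big_split; apply: eq_bigr => i _ /=.
    by rewrite dotZr; ring.
  rewrite -big_distrr -dot_sumr /v dotDr !dotZr /=; ring.
under eq_bigr do rewrite split_exponent.
apply: (@le_trans _ _ (\sum_(r : signs n)
   (expR (- K) * expR (dot (sign_vec R r) (2 *: v))
    + expR K * expR (- (16 * theta ^+ 2 * Z r))) / 2)).
  apply: ler_sum => r _; rewrite (le_trans (expRD_le_mean _ _))//.
  rewrite -!expRD dotZr ler_pM2r ?invr_gt0// le_eqVlt; apply/orP; left; apply/eqP.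
  by congr (expR _ + expR _); field.
rewrite -big_distrl big_split -!big_distrr /= ler_pdivrMr//.
have N_ge0 : 0 <= #|{: signs n}|%:R :> R by [].
have part1 : expR (- K) * \sum_(r : signs n) expR (dot (sign_vec R r) (2 *: v))
    <= #|{: signs n}|%:R.
  apply: (@le_trans _ _ (expR (- K) * (#|{: signs n}|%:R * expR K))).
    rewrite ler_wpM2l ?expR_ge0// (le_trans (sum_sign_expR _))//.
    by rewrite ler_wpM2l// ler_expR sqnorm2Z; lra.
  by rewrite mulrCA -expRD addNr expR0 mulr1.
have part2 : expR K * \sum_(r : signs n) expR (- (16 * theta ^+ 2 * Z r))
    <= #|{: signs n}|%:R.
  apply: (@le_trans _ _ (expR K * (#|{: signs n}|%:R * expR (- K)))).
    rewrite ler_wpM2l ?expR_ge0//.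
    apply: (@le_trans _ _ (\sum_(r : signs n) (1 - 12 * theta ^+ 2 * Z r))).
      apply: ler_sum => r _.
      have -> : 12 * theta ^+ 2 * Z r = 3 / 4 * (16 * theta ^+ 2 * Z r) by field.
      apply: expRN_le_affine; have := Z_ge0 r; have := Z_le1 r.
      by have := sqr_ge0 theta; nra.
    rewrite sumrB -big_distrr sumZ sumr_const /=.
    have -> : 1 *+ #|{: signs n}|
          - 12 * theta ^+ 2 * (#|{: signs n}|%:R * (g ^+ 2 * W))
        = #|{: signs n}|%:R * (1 + - (12 * theta ^+ 2 * g ^+ 2 * W)) :> R by ring.
    rewrite ler_wpM2l// (le_trans (expR_ge1Dx _))// ler_expR lerN2 /K.
    by rewrite ler_wpM2r// ler_wpM2r ?sqr_ge0// ler_wpM2r ?sqr_ge0//; lra.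
  by rewrite mulrCA -expRD subrr expR0 mulr1.
lra.
Qed.

End SignAverages.

(** * Sums over histories of draws *)

Section HistorySums.
Variables (R : realType) (X : finType).
Implicit Types F : seq X -> R.

Lemma sum_rev_tuple F (m : nat) :
  \sum_(w : m.-tuple X) F (rev w) = \sum_(w : m.-tuple X) F w.
Proof.
have revK : involutive (fun w : m.-tuple X => rev_tuple w).
  by move=> w; apply: val_inj; rewrite /= revK.
rewrite (reindex_inj (inv_inj revK)) /=; apply: eq_bigr => w _.
by rewrite [rev _](congr1 val (revK w)).
Qed.

Lemma sum_tuple_cons F (m : nat) :
  \sum_(w : m.+1.-tuple X) F w = \sum_(w : m.-tuple X) \sum_(r : X) F (r :: w).
Proof.
rewrite pair_big (reindex (fun p : m.-tuple X * X => [tuple of p.2 :: p.1]))//=.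
exists (fun w : m.+1.-tuple X => ([tuple of behead w], thead w)).
  by move=> [w r] _; congr pair; apply: val_inj.
by move=> w _; rewrite [RHS]tuple_eta; apply: val_inj.
Qed.

(** A conditional expectation is here an average over the next draw, the head of the history.
    Reversing tuples preserves the total sum, and the induction peels off the latest draw. *)
Lemma supermartingale_sum F (T : nat) :
  (forall h, (size h < T)%N -> \sum_(r : X) F (r :: h) <= #|X|%:R * F h) ->
  \sum_(w : T.-tuple X) F (rev w) <= #|{: T.-tuple X}|%:R * F [::].
Proof.
move=> F_super; rewrite sum_rev_tuple card_tuple natrX.
suff H m : (m <= T)%N -> \sum_(w : m.-tuple X) F w <= #|X|%:R ^+ m * F [::].
  exact: H.
elim: m => [|m IHm] m_le.
  by rewrite (big_pred1 [tuple]) ?mul1r// => w; apply/esym/eqP; rewrite [w]tuple0.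
rewrite sum_tuple_cons exprS -mulrA.
apply: le_trans (ler_wpM2l _ (IHm (ltnW m_le))) => //.
rewrite big_distrr /=; apply: ler_sum => w _.
by apply: F_super; rewrite size_tuple.
Qed.

End HistorySums.

(** * The walk: one step, and bounds on the coordinates *)

Section Walk.
Variables (R : realType) (n t : nat) (Sys : {set {set 'I_n}}).
Variables (sol : solver R n) (T : nat) (S : {set 'I_n}).
Hypothesis sol_feasible : forall h, (size h < T)%N ->
  sdp_feasible Sys t (alive sol h) (coloring sol h) (sol h).
Hypothesis SinSys : S \in Sys.
Implicit Types (h : seq (signs n)) (r : signs n) (i : 'I_n).

Local Notation x := (coloring sol).
Local Notation A := (alive sol).
Local Notation step h r i := (gamma R n * dot (sign_vec R r) (sol h i)).

Lemma coloring_cons r h i :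
  x (r :: h) i = if i \in A h then x h i + step h r i else x h i.
Proof. by rewrite /coloring /alive /=; case: (state sol h). Qed.

Lemma alive_cons r h :
  A (r :: h) = A h :\: [set i | 1 - 1 / n%:R <= `|x (r :: h) i| ].
Proof. by rewrite /coloring /alive /=; case: (state sol h). Qed.

Lemma alive_cons_sub r h : A (r :: h) \subset A h.
Proof. by rewrite alive_cons subsetDl. Qed.

Lemma alive_coloring_le h i : i \in A h -> `|x h i| <= 1 - 1 / n%:R.
Proof.
case: h => [_|r h].
  rewrite normr0 subr_ge0 ler_pdivrMr ?mul1r ?ler1n ?ltr0n;
  exact: leq_ltn_trans (ltn_ord i).
by rewrite alive_cons !inE -ltNge => /andP[/ltW].
Qed.

Lemma step_le r h i : (size h < T)%N -> i \in A h ->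
  `|step h r i| <= 1 / n%:R + 1 / 4.
Proof.
move=> h_lt iA; rewrite -ler_sqr ?nnegrE ?addr_ge0 ?divr_ge0//.
rewrite real_normK ?num_real// exprMn; apply: le_trans (gamma_sqr_mul_le R n).
rewrite ler_wpM2l ?sqr_ge0// (le_trans (sqr_dot_sign_le _ _))//.
by rewrite ler_piMr// (sdp_unit (sol_feasible h_lt)).
Qed.

Lemma coloring_le h i : (size h <= T)%N -> `|x h i| <= 5 / 4.
Proof.
elim: h => [|r h IHh] /= h_le; first by rewrite normr0 divr_ge0.
rewrite coloring_cons; case: ifP => iA; last exact/IHh/ltnW.
rewrite (le_trans (ler_normD _ _))//.
by have := alive_coloring_le iA; have := step_le r h_le iA; lra.
Qed.

Lemma coloring_sqr_le h i : (size h <= T)%N -> 0 <= 25 / 16 - x h i ^+ 2.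
Proof.
by move=> /(coloring_le i); rewrite ler_norml => /andP[]; nra.
Qed.

(** * Big and small phases, and a deterministic bound on the discrepancy *)

Definition big h := (param_a * t <= #|S :&: A h|)%N.

Lemma big_cons r h : big (r :: h) -> big h.
Proof.
by move=> /leq_trans; apply; rewrite subset_leq_card// setIS ?alive_cons_sub.
Qed.

Lemma card_small h : ~~ big h -> #|S :&: A h|%:R <= 6 * t%:R :> R.
Proof. by rewrite -ltnNge => /ltnW; rewrite -natrM ler_nat. Qed.

Definition disc h : R := \sum_(i in S) x h i.

Lemma disc_cons r h :
  disc (r :: h) = disc h + \sum_(i in S :&: A h) step h r i.
Proof.
under [X in _ + X]eq_bigl do rewrite inE.
rewrite /disc big_mkcondr -big_split; apply: eq_bigr => i _ /=.
by rewrite coloring_cons; case: ifP; rewrite ?addr0.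
Qed.

Lemma disc_cons_big r h : (size h < T)%N -> big h -> disc (r :: h) = disc h.
Proof.
move=> h_lt h_big; rewrite disc_cons -big_distrr -dot_sumr /=.
have /sqnorm2_eq0-> : sqnorm2 (\sum_(i in S :&: A h) sol h i) = 0.
  by apply: (sdp_big (sol_feasible h_lt)); rewrite inE SinSys.
by rewrite /dot big1 ?mulr0 ?addr0// => j _; rewrite !mxE mulr0.
Qed.

Lemma disc_nil : disc [::] = 0.
Proof. by rewrite /disc big1. Qed.

(** Alive sets only shrink, so a set big now was big at every earlier step, and none of them moved
    its discrepancy. *)
Lemma disc_big h : (size h <= T)%N -> big h -> disc h = 0.
Proof.
elim: h => [|r h IHh] h_le h_big; first exact: disc_nil.
by rewrite disc_cons_big ?IHh ?(ltnW h_le)//; exact: big_cons h_big.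
Qed.

Lemma discID h :
  disc h = \sum_(i in S :&: A h) x h i + \sum_(i in S :\: A h) x h i.
Proof. by rewrite /disc (big_setID (A h)). Qed.

Lemma sum_coloring_le h (B : {set 'I_n}) : (size h <= T)%N ->
  `|\sum_(i in B) x h i| <= 5 / 4 * #|B|%:R.
Proof.
move=> h_le; rewrite (le_trans (ler_norm_sum _ _ _))//.
rewrite (@le_trans _ _ (\sum_(i in B) 5 / 4))//.
  by apply: ler_sum => i _; exact: coloring_le.
by rewrite sumr_const mulr_natr.
Qed.

(* Every element that gets frozen moves at most 5/4 from the second term to the
   first one. *)
Lemma frozen_le h : (size h <= T)%N -> ~~ big h ->
  `|\sum_(i in S :\: A h) x h i| + 5 / 4 * #|S :&: A h|%:R <= 15 * t%:R.
Proof.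
elim: h => [|r h IHh] h_le h_small.
  rewrite [A [::]]/= setDT big_set0 normr0 add0r.
  by have := card_small h_small; have : 0 <= t%:R :> R by []; lra.
have [h_big|small_h] := boolP (big h).
  have := discID (r :: h); rewrite disc_cons_big// disc_big ?(ltnW h_le)//.
  move=> /esym/eqP; rewrite addrC addr_eq0 => /eqP->; rewrite normrN.
  have := sum_coloring_le (S :&: A (r :: h)) h_le.
  by have := card_small h_small; lra.
(* Otherwise the newly frozen elements, [B] below, pass from one term to the other; those frozen
   before keep their values. *)
have AE : S :\: A (r :: h) =
    (S :\: A h) :|: ((S :&: A h) :\: (S :&: A (r :: h))).
  apply/setP => i; rewrite !inE; have := subsetP (alive_cons_sub r h) i.
  by case: (i \in S); case: (i \in A h); case: (i \in A (r :: h)) => // ->.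
have disj : [disjoint S :\: A h & (S :&: A h) :\: (S :&: A (r :: h))].
  rewrite -setI_eq0; apply/eqP/setP => i; rewrite !inE.
  by case: (i \in A h); rewrite ?andbF.
rewrite AE; under eq_bigl do rewrite in_setU.
rewrite bigU//=; set B := (S :&: A h) :\: _ in disj *.
have -> : \sum_(i in S :\: A h) x (r :: h) i = \sum_(i in S :\: A h) x h i.
  apply: eq_bigr => i; rewrite !inE coloring_cons.
  by move=> /andP[/negbTE->].
have -> : #|S :&: A (r :: h)|%:R = #|S :&: A h|%:R - #|B|%:R :> R.
  have sub : S :&: A (r :: h) \subset S :&: A h.
    by rewrite setIS// alive_cons_sub.
  rewrite -(cardsID (S :&: A (r :: h)) (S :&: A h)) -/B natrD addrK.
  by rewrite (setIidPr sub).
have := IHh (ltnW h_le) small_h; have := sum_coloring_le B h_le.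
have := ler_normD (\sum_(i in S :\: A h) x h i) (\sum_(i in B) x (r :: h) i).
lra.
Qed.

Lemma disc_le h : (size h <= T)%N -> `|disc h| <= 15 * t%:R.
Proof.
move=> h_le; have [h_big|h_small] := boolP (big h).
  by rewrite disc_big// normr0 mulr_ge0.
rewrite discID (le_trans (ler_normD _ _))//.
by have := frozen_le h_le h_small; have := sum_coloring_le (S :&: A h) h_le; lra.
Qed.

(** * The exponential supermartingale *)

Section Potential.
Variable theta : R.

(* While S is big its discrepancy stays 0, and the energy released later by its
   alive elements is at most 25/16 for each of the at most 6 t of them. *)
Definition potential h : R :=
  if big h then expR (75 * theta ^+ 2 * t%:R)
  else expR (theta * disc h +
             8 * theta ^+ 2 * \sum_(i in S :&: A h) (25 / 16 - x h i ^+ 2)).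

Lemma rate_ge0 : 0 <= 8 * theta ^+ 2.
Proof. by rewrite pmulr_rge0 ?sqr_ge0. Qed.

Lemma energy_le h : ~~ big h ->
  8 * theta ^+ 2 * \sum_(i in S :&: A h) (25 / 16 - x h i ^+ 2)
    <= 75 * theta ^+ 2 * t%:R.
Proof.
move=> h_small.
have -> : 75 * theta ^+ 2 * t%:R = 8 * theta ^+ 2 * (25 / 16 * (6 * t%:R)).
  by field.
rewrite ler_wpM2l ?rate_ge0//.
apply: (@le_trans _ _ (25 / 16 * #|S :&: A h|%:R)); last first.
  by rewrite ler_wpM2l ?divr_ge0 ?card_small.
rewrite mulr_natr -sumr_const; apply: ler_sum => i _.
by have := sqr_ge0 (x h i); lra.
Qed.

(** Serves both at the start and at the step where S passes from big to small: the discrepancy is 0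
    in either case. *)
Lemma potential_le h : disc h = 0 ->
  potential h <= expR (75 * theta ^+ 2 * t%:R).
Proof.
move=> disc0; rewrite /potential; case: ifPn => // h_small.
by rewrite disc0 mulr0 add0r ler_expR energy_le.
Qed.

Lemma potential_ge h : (size h <= T)%N -> expR (theta * disc h) <= potential h.
Proof.
move=> h_le; rewrite /potential; case: ifPn => [h_big|_].
  by rewrite disc_big// mulr0 ler_expR mulr_ge0// pmulr_rge0 ?sqr_ge0.
rewrite ler_expR lerDl mulr_ge0 ?rate_ge0// sumr_ge0// => i _.
exact: coloring_sqr_le.
Qed.

Lemma potential_super h : `|theta| <= 1 / 32 -> (size h < T)%N ->
  \sum_(r : signs n) potential (r :: h) <= #|{: signs n}|%:R * potential h.
Proof.
move=> theta_le h_lt; have [h_big|h_small] := boolP (big h).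
  rewrite {2}/potential h_big mulr_natl -sumr_const; apply: ler_sum => r _.
  by apply: potential_le; rewrite disc_cons_big ?disc_big// ltnW.
have SL : S \in small_sets Sys t (A h).
  by rewrite !inE SinSys andbT /= -/(big h).
have [_ /(_ S SL) hU /(_ S SL) hx h1] := sol_feasible h_lt.
have U_le1 i : i \in S :&: A h -> sqnorm2 (sol h i) <= 1.
  by rewrite inE => /andP[_ /h1].
have := sum_sign_step (gamma_ge0 R n) (gamma_mul_le1 R n) theta_le hU hx U_le1.
have pot_ge0 : 0 <= potential h.
  by rewrite /potential; case: ifP => _; rewrite expR_ge0.
move=> /(ler_wpM2l pot_ge0); rewrite [leRHS]mulrC; apply: le_trans.
rewrite big_distrr; apply: ler_sum => r _ /=.
rewrite /potential (negbTE h_small) (negbTE (contra (@big_cons r h) h_small)).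
rewrite -expRD ler_expR disc_cons.
(* The energy left drops by at least the increase of the squares: elements frozen at this step take
   a nonnegative share with them, because |x i| <= 5/4. *)
have : \sum_(i in S :&: A (r :: h)) (25 / 16 - x (r :: h) i ^+ 2)
    <= \sum_(i in S :&: A h) (25 / 16 - x h i ^+ 2)
       - \sum_(i in S :&: A h) ((x h i + step h r i) ^+ 2 - x h i ^+ 2).
  rewrite -sumrB.
  have sub : S :&: A (r :: h) \subset S :&: A h.
    by rewrite setIS// alive_cons_sub.
  rewrite [leRHS](big_setID (S :&: A (r :: h))) /= (setIidPr sub).
  have stepE i : i \in S :&: A h ->
      25 / 16 - x h i ^+ 2 - ((x h i + step h r i) ^+ 2 - x h i ^+ 2)
      = 25 / 16 - x (r :: h) i ^+ 2.
    by rewrite inE coloring_cons => /andP[_ ->]; ring.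
  rewrite -[leLHS]addr0 lerD//.
    by apply: ler_sum => i /(subsetP sub) /stepE->.
  apply: sumr_ge0 => i; rewrite inE => /andP[_ /stepE->].
  exact: coloring_sqr_le.
by move=> /(ler_wpM2l rate_ge0); lra.
Qed.

Lemma sum_expR_disc_le : `|theta| <= 1 / 32 ->
  \sum_(w : T.-tuple (signs n)) expR (theta * disc (rev w))
    <= #|{: T.-tuple (signs n)}|%:R * expR (75 * theta ^+ 2 * t%:R).
Proof.
move=> theta_le.
apply: (@le_trans _ _ (\sum_(w : T.-tuple (signs n)) potential (rev w))).
  by apply: ler_sum => w _; rewrite potential_ge// size_rev size_tuple.
apply: le_trans (supermartingale_sum _) _.
  by move=> h; exact: potential_super.
by rewrite ler_wpM2l// potential_le// disc_nil.
Qed.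

End Potential.
End Walk.

(** * The tail bound, by Markov's inequality *)

Theorem theorem6 (R : realType) (n t : nat) (Sys : {set {set 'I_n}})
    (t_gt0 : (0 < t)%N) (degSys : max_degree Sys t)
    (sol : solver R n) (sol_opt : optimal_solver Sys t sol)
    (S : {set 'I_n}) (SinSys : S \in Sys)
    (lambda : R) (lambda_ge0 : 0 <= lambda) :
  unif_pr R [set w : outcome R n |
      lambda * Num.sqrt t%:R <= `|final_disc sol S w| ]
    <= 8 * expR (- (lambda ^+ 2 / (100 * param_a)%:R)).
Proof.
set E := [set w | _]; set N := #|{: outcome R n}|%:R : R.
have feas h : (size h < num_steps R n)%N ->
    sdp_feasible Sys t (alive sol h) (coloring sol h) (sol h).
  by move=> /sol_opt[].
pose s : R := Num.sqrt t%:R.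
have s2 : s ^+ 2 = t%:R by rewrite sqr_sqrtr.
have s_gt0 : 0 < s by rewrite sqrtr_gt0 ltr0n.
(* Beyond 15 s the event is empty, as |D| <= 15 t = 15 s^2. Below, [theta] is at most 15/480 =
   1/32. *)
have [lambda_le|lambda_gt] := lerP lambda (15 * s); last first.
  have -> : E = set0.
    apply/setP => w; rewrite !inE; apply/negbTE; rewrite -ltNge.
    have h_le : (size (rev w) <= num_steps R n)%N by rewrite size_rev size_tuple.
    apply: le_lt_trans (disc_le feas SinSys h_le) _.
    by rewrite -/s -s2 expr2 mulrA ltr_pM2r.
  by rewrite /unif_pr cards0 mul0r mulr_ge0 ?expR_ge0.
have N_gt0 : 0 < N.
  by rewrite ltr0n; apply/card_gt0P; exists [tuple of nseq _ [ffun=> true]].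
pose theta := lambda / (480 * s).
have theta_ge0 : 0 <= theta by rewrite divr_ge0// mulr_ge0// ltW.
have theta_le : `|theta| <= 1 / 32.
  by rewrite ger0_norm// ler_pdivrMr ?mulr_gt0//; lra.
have thetaN_le : `|- theta| <= 1 / 32 by rewrite normrN.
rewrite /unif_pr -/N ler_pdivrMr//.
have hp := sum_expR_disc_le feas SinSys theta_le.
have hn := sum_expR_disc_le feas SinSys thetaN_le.
rewrite sqrrN in hn.
pose L := theta * (lambda * s).
(* On the event, theta D or -theta D is at least [L], so the indicator is at most the sum of two
   exponentials. *)
have cardE : #|E|%:R <= expR (- L) * (
    \sum_(w : outcome R n) expR (theta * disc sol S (rev w)) +
    \sum_(w : outcome R n) expR (- theta * disc sol S (rev w))).
  rewrite -sum1_card natr_sum -big_split big_distrr /= big_mkcond /=.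
  apply: ler_sum => w _; case: ifPn => [|_]; last first.
    by rewrite mulr_ge0 ?addr_ge0 ?expR_ge0.
  rewrite inE -/s -[final_disc _ _ _]/(disc sol S (rev w)) => wE.
  rewrite mulrDr -!expRD.
  move: wE; case: ger0P => _ /(ler_wpM2l theta_ge0) wE.
    rewrite -[leLHS]addr0 lerD ?expR_ge0// -expR0 ler_expR /L; lra.
  rewrite -[leLHS]add0r lerD ?expR_ge0// -expR0 ler_expR /L; lra.
have exp_le : expR (- L) * expR (75 * theta ^+ 2 * t%:R)
    <= expR (- (lambda ^+ 2 / (100 * param_a)%:R)).
  rewrite -expRD ler_expR.
  (* 27/32 = 1 - 75/480, and 27/(32 * 480) exceeds 1/600. *)
  have -> : - L + 75 * theta ^+ 2 * t%:R = - (27 / 32 * (lambda ^+ 2 / 480)).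
    by rewrite /L /theta -s2; field; rewrite gt_eqF.
  by rewrite lerN2 /param_a natrM; have := sqr_ge0 lambda; lra.
have := ler_wpM2l (ltW N_gt0) exp_le; have := expR_gt0 (- L).
have := expR_ge0 (- (lambda ^+ 2 / (100 * param_a)%:R)).
(* The two signs of theta give a factor 2, within the 8 allowed. *)
by rewrite -/N in hp hn; nra.
Qed.
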